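(* Let $(X,d)$ be a geodesic space with convex metric, $C \subseteq X$ a nonempty and bounded set with diameter $d_C \le b$. Let $\lambda\in(0,1)$ and suppose $T : C \to C$ is $\lambda$-firmly nonexpansive. Then for all $x \in C$, all $\varepsilon > 0$ and all $n \ge \Phi(\varepsilon, b, \lambda)$, $$d\left(T^n x, T^{n+1} x\right) \le \varepsilon,$$ where $$\Phi(\varepsilon, b, \lambda) := M\left\lceil \frac{2 b (1 + e^{KM})}{\varepsilon}\right\rceil, \qquad K = \left\lceil \frac{1}{\lambda}\right\rceil, \qquad M = \left\lceil\frac{4b}{\varepsilon}\right\rceil.$$
   Context: A geodesic path from $x$ to $y$ in a metric space $(X,d)$ is a map $c:[0,l]\to X$ with $c(0)=x$, $c(l)=y$ and $d(c(t),c(t'))=|t-t'|$ for all $t,t'\in[0,l]$; its image is a geodesic segment joining $x$ and $y$. $X$ is a geodesic space if any two points are joined by a geodesic path (not necessarily unique). A point $z$ lies on a geodesic segment $[x,y]$ iff for some $t\in[0,1]$ one has $d(z,x)=t\,d(x,y)$ and $d(z,y)=(1-t)d(x,y)$, and one writes $z=(1-t)x+ty$ (such a point need not be unique when several segments join $x$ and $y$). The metric is convex if for all $x,y,z\in X$ and $t\in[0,1]$, $d(x,(1-t)y+tz)\le(1-t)d(x,y)+t\,d(x,z)$. For $C\subseteq X$ and $\lambda\in(0,1)$, a map $T:C\to X$ is $\lambda$-firmly nonexpansive if $T$ is nonexpansive ($d(Tx,Ty)\le d(x,y)$ for all $x,y\in C$) and for all $x,y\in C$, $$d(Tx,Ty)\le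 d((1-\lambda)x+\lambda Tx,(1-\lambda)y+\lambda Ty),$$ where, if $X$ is not uniquely geodesic, a geodesic segment joining $z$ and $Tz$ is fixed beforehand for each $z\in C$, and $(1-\lambda)z+\lambda Tz$ denotes the point of that segment at distance $\lambda d(z,Tz)$ from $z$. $C$ is not assumed convex. *)

(* Defs.v *)
From mathcomp Require Import all_boot all_order all_algebra.
From mathcomp Require Import all_classical all_reals all_analysis.

Set Implicit Arguments.
Unset Strict Implicit.
Unset Printing Implicit Defensive.

Import Order.TTheory GRing.Theory Num.Theory.

Local Open Scope classical_set_scope.
Local Open Scope ring_scope.

(* A path c : [0, l] -> X is a total function c : R -> X whose values outside
   [0, l] are irrelevant. *)
Definition geodesic_path (R : realType) (X : metricType R)
    (x y : X) (l : R) (c : R -> X) : Prop :=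
  [/\ 0 <= l, c 0 = x, c l = y &
      forall t t' : R, 0 <= t <= l -> 0 <= t' <= l ->
        mdist (c t) (c t') = `|t - t'|].

Definition geodesic_space (R : realType) (X : metricType R) : Prop :=
  forall x y : X, exists (l : R) (c : R -> X), geodesic_path x y l c.

(* z = (1 - t) x + t y, as a relation because the point need not be unique. *)
Definition is_comb (R : realType) (X : metricType R) (t : R) (x y z : X) : Prop :=
  mdist z x = t * mdist x y /\ mdist z y = (1 - t) * mdist x y.

Definition convex_metric (R : realType) (X : metricType R) : Prop :=
  forall (x y z w : X) (t : R), 0 <= t <= 1 -> is_comb t y z w ->
    mdist x w <= (1 - t) * mdist x y + t * mdist x z.

Definition diameter (R : realType) (X : metricType R) (C : set X) : \bar R :=
  ereal_sup [set (mdist x y)%:E | x in C & y in C].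

Definition bounded_subset (R : realType) (X : metricType R) (C : set X) : Prop :=
  exists B : R, forall x y : X, C x -> C y -> mdist x y <= B.

Definition nonexpansive_on (R : realType) (X : metricType R)
    (C : set X) (T : X -> X) : Prop :=
  forall x y : X, C x -> C y -> mdist (T x) (T y) <= mdist x y.

(* sigma fixes, for each z in C, a geodesic segment joining z and T z,
   parametrized by arc length from z. *)
Definition segment_choice (R : realType) (X : metricType R)
    (C : set X) (T : X -> X) (sigma : X -> R -> X) : Prop :=
  forall z : X, C z -> geodesic_path z (T z) (mdist z (T z)) (sigma z).

(* (1 - lambda) z + lambda T z on the segment fixed by sigma. *)
Definition segment_point (R : realType) (X : metricType R)
    (T : X -> X) (sigma : X -> R -> X) (lambda : R) (z : X) : X :=
  sigma z (lambda * mdist z (T z)).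

Definition firmly_nonexpansive_on (R : realType) (X : metricType R)
    (C : set X) (sigma : X -> R -> X) (lambda : R) (T : X -> X) : Prop :=
  nonexpansive_on C T /\
  forall x y : X, C x -> C y ->
    mdist (T x) (T y) <=
    mdist (segment_point T sigma lambda x) (segment_point T sigma lambda y).

Definition Phi (R : realType) (eps b lambda : R) : int :=
  let K : int := Num.ceil (1 / lambda) in
  let M : int := Num.ceil (4 * b / eps) in
  M * Num.ceil (2 * b * (1 + expR (K * M)%:~R) / eps).

(* Main.v *)
Require Import Defs.
From mathcomp Require Import all_boot all_order all_algebra.
From mathcomp Require Import all_classical all_reals all_analysis.
From mathcomp Require Import lra.

Import Order.TTheory GRing.Theory Num.Theory.

Local Open Scope classical_set_scope.
Local Open Scope ring_scope.

(** Write u_m = T^m x and suppose d(u_n, u_(n+1)) > eps.  Expanding the firmness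
    inequality by convexity of the metric gives a three-term inequality
    (firmly_nonexpansive_three_term) which says that, up to the decay of the
    distances in m, the gap d(u_m, u_(m+k)) is a convex function of k that
    vanishes at k = 0.  Hence, on a stretch of M consecutive indices along
    which the step d(u_m, u_(m+1)) barely decreases, the gap grows almost
    linearly in k (gap_growth): starting from a step of length r that loses at
    most delta, one finds d(u_s, u_(s+M)) >= M r - (1 + 1/lambda)^M delta.

    Such a stretch exists by pigeonhole (almost_constant_block): up to time n
    the steps are positive, nonincreasing and at most b, so among at least
    b / delta consecutive blocks of length M one loses at most delta.  Taking
    delta = eps / (2 (1 + e^(K M))) makes the error term at most eps / 2, since
    (1 + 1/lambda)^M <= (1 + K)^M <= e^(K M), and M >= 4 b / eps makes
    M r >= 4 b.  As eps < b, the resulting gap exceeds b, contradicting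
    diam C <= b. *)

Lemma mdist_le_diameter (R : realType) (X : metricType R) (C : set X) (b : R) :
  (diameter C <= b%:E)%E ->
  forall x y : X, C x -> C y -> mdist x y <= b.
Proof.
move=> diamC x y Cx Cy; rewrite -lee_fin; apply: le_trans diamC.
by apply: ereal_sup_ubound; exists x => //; exists y.
Qed.

Lemma segment_point_comb (R : realType) (X : metricType R) (C : set X)
    (T : X -> X) (sigma : X -> R -> X) (lambda : R) (z : X) :
  segment_choice C T sigma -> 0 <= lambda <= 1 -> C z ->
  is_comb lambda z (T z) (segment_point T sigma lambda z).
Proof.
move=> sigmaP /andP[l0 l1] Cz; have [d0 c0 cd cdist] := sigmaP z Cz.
rewrite /segment_point; set d := mdist z (T z) in d0 cd cdist *.
have ld0 : 0 <= lambda * d by rewrite mulr_ge0.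
have ldd : lambda * d <= d by rewrite ler_piMl.
split.
  rewrite -[X in mdist _ X]c0 cdist ?lexx ?ld0 ?d0 //.
  by rewrite subr0 ger0_norm.
rewrite -[X in mdist _ X]cd cdist ?lexx ?ld0 ?d0 //.
by rewrite distrC ger0_norm ?subr_ge0 // mulrBl mul1r.
Qed.

(** The geodesics enter the argument only through this inequality, obtained by
    expanding the firmness inequality in both arguments by convexity and
    dividing by 1 - lambda. *)
Lemma firmly_nonexpansive_three_term (R : realType) (X : metricType R)
    (C : set X) (T : X -> X) (sigma : X -> R -> X) (lambda : R) :
  convex_metric X -> 0 < lambda < 1 -> segment_choice C T sigma ->
  firmly_nonexpansive_on C sigma lambda T ->
  forall x y : X, C x -> C y ->
    (1 + lambda) * mdist (T x) (T y) <=
    (1 - lambda) * mdist x y + lambda * (mdist (T x) y + mdist x (T y)).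
Proof.
move=> convX /andP[l0 l1] sigmaP [_ firmT] x y Cx Cy.
have l01 : 0 <= lambda <= 1 by rewrite !ltW.
have cx := segment_point_comb R X C T sigma lambda x sigmaP l01 Cx.
have cy := segment_point_comb R X C T sigma lambda y sigmaP l01 Cy.
have := firmT x y Cx Cy.
set xl := segment_point _ _ _ x in cx *; set yl := segment_point _ _ _ y in cy *.
have h1 := convX xl _ _ _ _ l01 cy.
have h2 := convX y _ _ _ _ l01 cx.
have h3 := convX (T y) _ _ _ _ l01 cx.
rewrite (metric_sym y) (metric_sym y x) (metric_sym y (T x)) in h2.
rewrite (metric_sym (T y)) (metric_sym _ x) (metric_sym _ (T x)) in h3.
nra.
Qed.

Section SequenceWithThreeTermInequality.
Variables (R : realType) (X : metricType R) (u : nat -> X) (lambda : R).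
Hypothesis l01 : 0 < lambda < 1.
Hypothesis u_nonexp : forall m k : nat,
  mdist (u m.+1) (u k.+1) <= mdist (u m) (u k).
Hypothesis u_three_term : forall m k : nat,
  (1 + lambda) * mdist (u m.+1) (u k.+1) <=
  (1 - lambda) * mdist (u m) (u k) +
  lambda * (mdist (u m.+1) (u k) + mdist (u m) (u k.+1)).

Lemma step_nonincreasing (m k : nat) : (m <= k)%N ->
  mdist (u k) (u k.+1) <= mdist (u m) (u m.+1).
Proof.
elim: k => [|k IH]; first by rewrite leqn0 => /eqP->.
rewrite leq_eqVlt ltnS => /orP[/eqP->//|/IH].
exact: le_trans (u_nonexp _ _).
Qed.

Lemma gap_le_step (s m k : nat) : (s <= m)%N ->
  mdist (u m) (u (m + k)%N) <= k%:R * mdist (u s) (u s.+1).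
Proof.
move=> sm; elim: k => [|k IH]; first by rewrite addn0 mdistxx mul0r.
rewrite addnS (le_trans (metric_triangle _ (u (m + k)%N) _)) //.
rewrite -natr1 mulrDl mul1r lerD // step_nonincreasing //.
exact: leq_trans (leq_addr _ _).
Qed.

(** Convexity in k of the gaps: each increment of k shifts the starting index
    back by one and multiplies the error by 1 + 1/lambda. *)
Lemma gap_growth (s M : nat) (delta : R) :
  0 <= delta ->
  mdist (u s) (u s.+1) - delta <= mdist (u (s + M)%N) (u (s + M).+1) ->
  forall k m : nat, (s <= m)%N -> (m + k)%N = (s + M)%N ->
    k.+1%:R * mdist (u s) (u s.+1) - (1 + lambda^-1) ^+ k * delta
    <= mdist (u m) (u (m + k.+1)%N).
Proof.
move=> d0 hM; have /andP[l0 l1] := l01; elim=> [|k IH] m sm mk.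
  by rewrite expr0 !mul1r addn1; rewrite addn0 in mk; rewrite mk.
have {IH} low := IH m.+1 (leqW sm) (etrans (addSnnS _ _) mk).
have up := gap_le_step s m k.+1 sm.
have up' := gap_le_step s m.+1 k (leqW sm).
have three := u_three_term m (m + k.+1)%N.
rewrite !addSn !addnS in low up up' three *.
rewrite exprS -mulrA; set e := _ ^+ k * delta in low *.
have errE : lambda * ((1 + lambda^-1) * e) = (lambda + 1) * e.
  by rewrite mulrA mulrDr mulr1 mulfV ?gt_eqF.
rewrite -(ler_pM2l l0) mulrBr errE.
rewrite -(ler_pM2l (addr_gt0 ltr01 l0)) in low.
rewrite -!natr1 in low up *.
have l1' : 0 <= 1 - lambda by rewrite subr_ge0 ltW.
have := ler_wpM2l l1' up; have := ler_wpM2l (ltW l0) up'.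
lra.
Qed.

End SequenceWithThreeTermInequality.

(** By contraposition: a sequence that loses more than delta on each of P successive
    blocks of length M loses at least P delta in total. *)
Lemma almost_constant_block (R : realType) (f : nat -> R) (M P : nat)
    (delta : R) :
  f 0%N - P%:R * delta < f (P * M)%N ->
  exists2 j : nat, (j < P)%N & f (j * M)%N - delta <= f (j * M + M)%N.
Proof.
elim: P => [|P IH]; first by rewrite mul0r subr0 mul0n ltxx.
have [h _|h] := leP (f (P * M)%N - delta) (f (P * M + M)%N); first by exists P.
rewrite mulSnr -natr1 => hP.
have [|j jP hj] := IH; last by exists j => //; exact: leqW.
lra.
Qed.

Lemma exprD1_le_expR (R : realType) (a k : R) (n : nat) :
  0 <= a <= k -> (1 + a) ^+ n <= expR (k * n%:R).
Proof.
move=> /andP[a0 ak]; rewrite expRM_natr lerXn2r ?nnegrE ?expR_ge0 //.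
  by rewrite addr_ge0.
by rewrite (le_trans _ (expR_ge1Dx _)) // lerD2l.
Qed.

Theorem corollary4p6 (R : realType) (X : metricType R)
    (geodX : geodesic_space X) (convX : convex_metric X)
    (C : set X) (b : R)
    (C_nonempty : C !=set0) (C_bounded : bounded_subset C)
    (diamC : (diameter C <= b%:E)%E)
    (lambda : R) (lambda01 : 0 < lambda < 1)
    (T : X -> X) (TC : set_fun C C T)
    (sigma : X -> R -> X) (sigmaP : segment_choice C T sigma)
    (firmT : firmly_nonexpansive_on C sigma lambda T) :
  forall x : X, C x ->
  forall eps : R, 0 < eps ->
  forall n : nat, Phi eps b lambda <= n%:Z ->
    mdist (iter n T x) (iter n.+1 T x) <= eps.
Proof.
move=> x Cx eps eps0 n Phin.
have l0 : 0 < lambda by case/andP: lambda01.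
pose u m := iter m T x.
have Cu m : C (u m) by elim: m => //= m; exact: TC.
have ub m k : mdist (u m) (u k) <= b.
  exact: (mdist_le_diameter R X C b diamC).
have nonexp m k : mdist (u m.+1) (u k.+1) <= mdist (u m) (u k).
  by have [+ _] := firmT; apply.
have three m k := firmly_nonexpansive_three_term
  R X C T sigma lambda convX lambda01 sigmaP firmT (u m) (u k) (Cu m) (Cu k).
rewrite leNgt; apply/negP => step_gt.
have b0 : 0 < b by exact: lt_le_trans (lt_trans eps0 step_gt) (ub n n.+1).
move: Phin; rewrite /Phi.
set K := Num.ceil (1 / lambda); set Mz := Num.ceil (4 * b / eps).
have hK : lambda^-1 <= K%:~R by rewrite -[lambda^-1]mul1r; exact: ceil_ge.
have hM : 4 * b / eps <= Mz%:~R by exact: ceil_ge.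
have M_gt0 : 0 < Mz by rewrite -(ltr0z R) (lt_le_trans _ hM) // divr_gt0 ?mulr_gt0.
case: Mz M_gt0 hM => // -[//|M] _ hM.
set E := expR _; set Pz := Num.ceil _.
have E0 : 0 < E by exact: expR_gt0.
have hP : 2 * b * (1 + E) / eps <= Pz%:~R by exact: ceil_ge.
have P_ge0 : 0 <= Pz.
  by rewrite -(ler0z R) (le_trans _ hP) // divr_ge0 ?mulr_ge0 ?addr_ge0 ?ltW.
case: Pz P_ge0 hP => // P _ hP.
rewrite -PoszM lez_nat mulnC => PMn.
pose delta := eps / (2 * (1 + E)).
have delta0 : 0 < delta by rewrite divr_gt0 // mulr_gt0 // addr_gt0.
have hPd : b <= P%:R * delta.
  by rewrite /delta mulrA ler_pdivlMr ?mulr_gt0 ?addr_gt0 // -ler_pdivrMr //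
     mulrCA mulrA.
have step_gt' m : (m <= P * M.+1)%N -> eps < mdist (u m) (u m.+1).
  move=> mP; apply: (lt_le_trans step_gt).
  exact: (step_nonincreasing R X u nonexp _ _ (leq_trans mP PMn)).
pose step m := mdist (u m) (u m.+1).
have [|j jP hj] := almost_constant_block R step M.+1 P delta.
  rewrite (le_lt_trans _ (lt_trans eps0 (step_gt' _ (leqnn _)))) //.
  by rewrite subr_le0 (le_trans (ub _ _)).
set s := (j * M.+1)%N in hj.
(* Here M is one less than the block length; gap_growth reaches the gap of
   length M + 1 from the bound on the step at s + M alone. *)
have hj' : step s - delta <= step (s + M)%N.
  apply: (le_trans hj); apply: (step_nonincreasing R X u nonexp).
  by rewrite leq_add2l.
have := gap_growth R X u lambda lambda01 nonexp three s M delta (ltW delta0) hj'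
  M s (leqnn _) erefl.
have r_gt : eps < mdist (u s) (u s.+1).
  by apply: step_gt'; rewrite leq_mul2r (ltnW jP) orbT.
have powE : (1 + lambda^-1) ^+ M <= E.
  have ge1 : 1 <= 1 + lambda^-1 by rewrite lerDl invr_ge0 ltW.
  apply: (le_trans (ler_weXn2l ge1 (leqnSn M))).
  rewrite /E intrM; apply: exprD1_le_expR.
  by rewrite invr_ge0 ltW.
have Ed : E * delta <= eps / 2.
  rewrite /delta mulrA ler_pdivrMr ?mulr_gt0 ?addr_gt0 //; nra.
have Mr : 4 * b <= M.+1%:R * mdist (u s) (u s.+1).
  apply: (@le_trans _ _ (M.+1%:R * eps)); first by rewrite -ler_pdivrMr.
  by rewrite ler_pM2l // ltW.
have := ub s (s + M.+1)%N; have := ub s s.+1.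
have : (1 + lambda^-1) ^+ M * delta <= E * delta by rewrite ler_pM2r.
lra.
Qed.
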